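(* $\mathbf{G}_\uparrow=\bigcap_{m\ge 2}\mathbf{G}_m$.
   Context: Fix a standard first-order language with connectives $\wedge,\vee,\rightarrow$, constant $\bot$, quantifiers $\forall,\exists$. A Gödel set is a closed $V\subseteq[0,1]$ with $0,1\in V$. A $V$-interpretation $\mathfrak I$ has a nonempty universe $U$, assigns to each $k$-ary predicate symbol a function $U^k\to V$, to each $k$-ary function symbol a function $U^k\to U$, and to each variable an element of $U$; truth values are: atomic formulas get the value of the predicate function on the term values, $\bot\mapsto 0$, $\wedge\mapsto\min$, $\vee\mapsto\max$, $\mathfrak I(A\rightarrow B)=1$ if $\mathfrak I(A)\le\mathfrak I(B)$ and $\mathfrak I(B)$ otherwise, $\forall\mapsto\inf$ and $\exists\mapsto\sup$ of the values of the instances $A(u)$, $u\in U$. $\mathbf{G}_V$ is the set of formulas $A$ with $\mathfrak I(A)=1$ for all $V$-interpretations. $V_\uparrow=\{1-1/k:k\ge1\}\cup\{1\}$ and $V_m=\{1-1/k:1\le k\le m-1\}\cup\{1\}$; $\mathbf{G}_\uparrow=\mathbf{G}_{V_\uparrow}$ and $\mathbf{G}_m=\mathbf{G}_{V_m}$. *)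

(* Defs.v *)
From mathcomp Require Import all_boot all_order all_algebra.
From mathcomp Require Import all_classical all_reals topology normedtype.

Set Implicit Arguments.
Unset Strict Implicit.
Unset Printing Implicit Defensive.

Import Order.TTheory GRing.Theory Num.Theory.
Import numFieldNormedType.Exports.

Local Open Scope classical_set_scope.
Local Open Scope ring_scope.

Record signature := Signature {
  pred_sym : Type;
  pred_arity : pred_sym -> nat;
  fun_sym : Type;
  fun_arity : fun_sym -> nat }.

(* Individual variables are named by natural numbers; a k-tuple of elements
   of U is a function ['I_k -> U]. *)
Inductive term (L : signature) : Type :=
| Var (x : nat)
| App (f : fun_sym L) (args : 'I_(fun_arity f) -> term L).

Inductive formula (L : signature) : Type :=
| Atom (p : pred_sym L) (args : 'I_(pred_arity p) -> term L)
| Bot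
| And (A B : formula L)
| Or (A B : formula L)
| Imp (A B : formula L)
| Forall (x : nat) (A : formula L)
| Exists (x : nat) (A : formula L).

Arguments Var {L} x.
Arguments App {L} f args.
Arguments Atom {L} p args.
Arguments Bot {L}.

Definition goedel_set (R : realType) (V : set R) : Prop :=
  [/\ closed V, V `<=` `[0, 1], V 0 & V 1].

Record interpretation (L : signature) (R : realType) (V : set R) :=
  Interpretation {
    univ : Type;
    univ_nonempty : inhabited univ;
    pred_val : forall p : pred_sym L, ('I_(pred_arity p) -> univ) -> R;
    pred_val_in : forall (p : pred_sym L) a, V (@pred_val p a);
    fun_val : forall f : fun_sym L, ('I_(fun_arity f) -> univ) -> univ;
    var_val : nat -> univ }.

Definition update (U : Type) (s : nat -> U) (x : nat) (u : U) : nat -> U :=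
  fun y => if y == x then u else s y.

Section Semantics.
Context (L : signature) (R : realType) (V : set R).
Variable I : interpretation L V.

Fixpoint term_val (s : nat -> univ I) (t : term L) : univ I :=
  match t with
  | Var x => s x
  | App f args => @fun_val _ _ _ I f (fun i => term_val s (args i))
  end.

(* The instances A(u), for u in the universe, of a quantified formula are
   obtained by letting the bound variable denote u.
   [inf] and [sup] are total on [set R], with a default value on sets that are
   empty or unbounded; [formula_val_in] below shows that over a Gödel set this
   default is never met, because all values lie in [V]. *)
Fixpoint formula_val (s : nat -> univ I) (A : formula L) : R :=
  match A with
  | Atom p args => @pred_val _ _ _ I p (fun i => term_val s (args i))
  | Bot => 0
  | And A B => Num.min (formula_val s A) (formula_val s B)
  | Or A B => Num.max (formula_val s A) (formula_val s B)
  | Imp A B =>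
      if formula_val s A <= formula_val s B then 1 else formula_val s B
  | Forall x A => inf (range (fun u => formula_val (update s x u) A))
  | Exists x A => sup (range (fun u => formula_val (update s x u) A))
  end.

Definition truth_value (A : formula L) : R := formula_val (var_val I) A.

End Semantics.

Definition goedel_logic (L : signature) (R : realType) (V : set R) :
    set (formula L) :=
  [set A | forall I : interpretation L V, truth_value I A = 1].

Arguments goedel_logic L {R} V.

Definition V_up (R : realType) : set R :=
  [set 1 - k%:R^-1 | k in [set k : nat | (1 <= k)%N]] `|` [set 1].

Definition V_fin (R : realType) (m : nat) : set R :=
  [set 1 - k%:R^-1 | k in [set k : nat | (1 <= k <= m - 1)%N]] `|` [set 1].

Arguments V_up : clear implicits.
Arguments V_fin : clear implicits.

Definition G_up (L : signature) (R : realType) : set (formula L) :=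
  goedel_logic L (V_up R).

Definition G_fin (L : signature) (R : realType) (m : nat) : set (formula L) :=
  goedel_logic L (V_fin R m).

Arguments G_up : clear implicits.
Arguments G_fin : clear implicits.

Lemma V_fin_up (R : realType) (m : nat) : V_fin R m `<=` V_up R.
Proof.
move=> x [[k /andP[k1 _] <-]|->]; last by right.
by left; exists k.
Qed.

Lemma V_up_itv (R : realType) : V_up R `<=` `[0, 1].
Proof.
move=> x [[k /= k1 <-]|->] /=; rewrite in_itv /= ?ler01 ?lexx //.
by rewrite subr_ge0 invf_le1 ?ltr0n // ler1n k1 lerBlDr lerDl invr_ge0 ler0n.
Qed.

Lemma V_fin_closed (R : realType) (m : nat) : closed (V_fin R m).
Proof.
apply: closedU; last exact: closed_eq.
apply: (accessible_finite_set_closed.1 _ _).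
  exact/hausdorff_accessible/Rhausdorff.
apply: finite_image.
apply: (sub_finite_set _ (finite_II m)) => k /= /andP[k1 km].
by case: m km => [|m]; rewrite ?subn1 //=; case: k k1.
Qed.

Lemma V_fin_goedel (R : realType) (m : nat) :
  (2 <= m)%N -> goedel_set (V_fin R m).
Proof.
move=> m2; split; first exact: V_fin_closed.
- exact: (subset_trans (@V_fin_up R m) (@V_up_itv R)).
- by left; exists 1%N => /=; rewrite ?invr1 ?subrr // leq_subRL // ltnW.
- by right.
Qed.

Lemma V_up_goedel (R : realType) : goedel_set (V_up R).
Proof.
split; [|exact: V_up_itv| |by right]; last first.
  by left; exists 1%N => //; rewrite invr1 subrr.
have -> : V_up R = \bigcap_n (V_fin R n.+2 `|` `[1 - n.+1%:R^-1, 1]).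
  apply/seteqP; split => [x Vx n _|x Vx].
    have /= := V_up_itv Vx; rewrite in_itv /= => /andP[_ x1].
    case: Vx x1 => [[k /= k1 <-] x1|->]; last by left; right.
    have [kn|nk] := leqP k n.+1.
      by left; left; exists k => //=; rewrite k1 subn1.
    right; rewrite /= in_itv /= x1 andbT lerD2l lerN2.
    by rewrite lef_pV2 ?posrE ?ltr0n // ler_nat ltnW.
  have x1 : x <= 1.
    have [/V_fin_up/V_up_itv|] := Vx 0%N Logic.I;
      by rewrite /= in_itv /= => /andP[].
  move: x1; rewrite le_eqVlt => /predU1P[->|x1]; first by right.
  have [n xn] := ltr_add_invr x1.
  have [/V_fin_up //|] := Vx n Logic.I.
  by rewrite /= in_itv /= => /andP[+ _]; rewrite lerBlDr leNgt xn.
apply: closed_bigI => n _; apply: closedU; first exact: V_fin_closed.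
exact: itv_closed.
Qed.

Lemma formula_val_in (L : signature) (R : realType) (V : set R)
    (I : interpretation L V) (s : nat -> univ I) (A : formula L) :
  goedel_set V -> V (formula_val s A).
Proof.
move=> [Vcl V01 V0 V1]; have [u0] := univ_nonempty I.
have clP (E : set R) r : E `<=` V ->
    (forall e, 0 < e -> exists2 y, E y & `|r - y| < e) -> V r.
  move=> EV Er; apply: Vcl => B /nbhs_ballP[e /= e0 eB].
  have [y Ey ye] := Er _ e0; exists y; split; first exact: EV.
  exact: eB.
have V01' x : V x -> 0 <= x <= 1 by move=> /V01; rewrite /= in_itv.
elim: A s => [p args|//|A IA B IB|A IA B IB|A IA B IB|x A IA|x A IA] s //=.
- exact: pred_val_in.
- by rewrite /Num.min; case: ifP.
- by rewrite /Num.max; case: ifP.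
- by case: ifP.
- set E := (X in inf X); have EV : E `<=` V by move=> _ [u _ <-].
  have hE : has_inf E.
    split; first by eexists; exists u0.
    by exists 0 => y /EV/V01'/andP[].
  apply: (clP E) => // e e0; have [y Ey ye] := inf_adherent e0 hE.
  exists y => //; rewrite ler0_norm ?subr_le0; last by apply: ge_inf => //; case: hE.
  by rewrite opprB ltrBlDl.
- set E := (X in sup X); have EV : E `<=` V by move=> _ [u _ <-].
  have hE : has_sup E.
    split; first by eexists; exists u0.
    by exists 1 => y /EV/V01'/andP[].
  apply: (clP E) => // e e0; have [y Ey ye] := sup_adherent e0 hE.
  exists y => //; rewrite ger0_norm ?subr_ge0; last by apply: ub_le_sup => //; case: hE.
  by rewrite ltrBlDl -ltrBlDr.
Qed.

(* Main.v *)
Require Import Defs.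
From mathcomp Require Import all_boot all_order all_algebra.
From mathcomp Require Import all_classical all_reals topology normedtype.

(** A [V_m]-interpretation is a [V_up]-interpretation.  Conversely, if
    [A] takes a value [c < 1] in a [V_up]-interpretation, then replacing every
    value above [c] by [1] leaves only the finitely many values up to [c], and
    [1].  This truncation commutes with all the connectives; it commutes with
    infima because [c] is isolated from above in [V_up].  Hence [A] still takes
    the value [c] in the truncated interpretation, over some [V_m]. *)

Set Implicit Arguments.
Unset Strict Implicit.
Unset Printing Implicit Defensive.

Import Order.TTheory GRing.Theory Num.Theory.

Local Open Scope classical_set_scope.
Local Open Scope ring_scope.

Section MapInterpretation.
Context (L : signature) (R : realType) (V W : set R) (h : R -> R).
Hypothesis hVW : forall x, V x -> W (h x).

Definition map_interpretation (I : interpretation L V) : interpretation L W :=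
  Interpretation (univ_nonempty I) (fun p a => hVW (pred_val_in a))
    (@fun_val _ _ _ I) (var_val I).

Hypothesis V_goedel : goedel_set V.
Hypothesis h0 : h 0 = 0.
Hypothesis h1 : h 1 = 1.
Hypothesis h_homo : {homo h : x y / x <= y}.
Hypothesis h_imp : forall x y, y < x -> h x <= h y -> h y = 1.
Hypothesis h_inf :
  forall E, E !=set0 -> E `<=` V -> h (inf E) = inf (h @` E).
Hypothesis h_sup :
  forall E, E !=set0 -> E `<=` V -> h (sup E) = sup (h @` E).

(** Since [V] is a Gödel set, the instances of a quantified formula take values in [V], where
    [h_inf] and [h_sup] apply. *)
Lemma formula_val_map (I : interpretation L V) (s : nat -> univ I)
    (A : formula L) :
  @formula_val _ _ _ (map_interpretation I) s A = h (formula_val s A).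
Proof.
have [u0] := univ_nonempty I.
elim: A s => [p args||A IA B IB|A IA B IB|A IA B IB|x A IA|x A IA] s //=.
- rewrite IA IB; case: (leP (formula_val s A)) => [|/ltW] /h_homo hAB.
    by rewrite min_l.
  by rewrite min_r.
- rewrite IA IB; case: (leP (formula_val s A)) => [|/ltW] /h_homo hAB.
    by rewrite max_r.
  by rewrite max_l.
- rewrite IA IB; case: (leP (formula_val s A)) => [xy|yx].
    by rewrite h_homo.
  (* If [h] collapses the strict inequality, the mapped implication jumps to 1; by [h_imp] the image
     of the old value is then 1 too. *)
  by case: ifP => // hxy; rewrite (h_imp yx).
- have vV : range (fun u => formula_val (update s x u) A) `<=` V.
    by move=> _ [u _ <-]; exact: formula_val_in.
  rewrite h_inf //; last by eexists; exists u0.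
  by rewrite image_comp; congr inf; apply: eq_imagel => u _; exact: IA.
- have vV : range (fun u => formula_val (update s x u) A) `<=` V.
    by move=> _ [u _ <-]; exact: formula_val_in.
  rewrite h_sup //; last by eexists; exists u0.
  by rewrite image_comp; congr sup; apply: eq_imagel => u _; exact: IA.
Qed.

Lemma goedel_logic_map (A : formula L) (I : interpretation L V) :
  goedel_logic L W A -> h (truth_value I A) = 1.
Proof. by move=> /(_ (map_interpretation I)) <-; rewrite -formula_val_map. Qed.

End MapInterpretation.

(** Mapping along the identity turns a countermodel over [V] into one over [W]. *)
Lemma goedel_logic_sub (L : signature) (R : realType) (V W : set R) :
  goedel_set V -> V `<=` W -> goedel_logic L W `<=` goedel_logic L V.
Proof.
move=> gV VW A WA I.
apply: (goedel_logic_map (h := id) VW gV) => //.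
- by move=> x y /lt_geF ->.
- by move=> E _ _; rewrite image_id.
- by move=> E _ _; rewrite image_id.
Qed.

Section Truncation.
Context (R : realType) (c : R).

Definition truncate (x : R) : R := if x <= c then x else 1.

Lemma truncate_id x : x <= c -> truncate x = x.
Proof. by rewrite /truncate => ->. Qed.

Lemma truncate1 : truncate 1 = 1.
Proof. by rewrite /truncate; case: ifP. Qed.

Lemma truncate_gt x : c < x -> truncate x = 1.
Proof. by rewrite /truncate ltNge => /negbTE ->. Qed.

Hypothesis c1 : c < 1.

Lemma truncate_homo : {homo truncate : x y / x <= y}.
Proof.
move=> x y xy; have [yc|cy] := leP y c.
  by rewrite !truncate_id // (le_trans xy).
rewrite (truncate_gt cy); have [xc|/truncate_gt -> //] := leP x c.
by rewrite truncate_id // (le_trans xc) ?ltW.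
Qed.

(** When [y <= c], truncation leaves [y] fixed and sends [x] to [x] or to [1 > c], so strictness
    survives; it is lost only above [c]. *)
Lemma truncate_imp x y : y < x -> truncate x <= truncate y -> truncate y = 1.
Proof.
move=> yx; have [yc|/truncate_gt -> //] := leP y c.
rewrite (truncate_id yc); have [xc|/truncate_gt ->] := leP x c.
  by rewrite truncate_id // leNgt yx.
by rewrite leNgt (le_lt_trans yc).
Qed.

Variable E : set R.
Hypothesis E0 : E !=set0.

Lemma truncate_const : (forall x, E x -> c < x) -> truncate @` E = [set 1].
Proof.
move=> cE; case: E0 => x Ex; apply/seteqP; split => [_ [y /cE cy <-]|_ ->].
  exact: truncate_gt.
by exists x => //; exact: truncate_gt (cE _ Ex).
Qed.

(** Either [sup E <= c] and truncation fixes all of [E], or some member of [E] exceeds [c] and both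
    sides are 1. *)
Lemma truncate_sup :
  E `<=` `[0, 1] -> truncate (sup E) = sup (truncate @` E).
Proof.
move=> E01.
have hE : has_sup E.
  by split=> //; exists 1 => y /E01 /=; rewrite in_itv => /andP[].
have [sc|cs] := leP (sup E) c.
  rewrite truncate_id //; congr sup; rewrite -[LHS]image_id.
  apply: eq_imagel => x Ex; rewrite truncate_id // (le_trans _ sc) //.
  by apply: ub_le_sup => //; case: hE.
have [x Ex cx] : exists2 x, E x & c < x.
  (* The tolerance [sup E - c] yields a member of [E] above [c]. *)
  by have [x Ex] := sup_adherent (ltac:(by rewrite subr_gt0) : 0 < sup E - c) hE;
    rewrite subKr; exists x.
have t1 : ubound (truncate @` E) 1.
  move=> _ [y Ey <-]; rewrite -truncate1; apply: truncate_homo.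
  by have /= := E01 _ Ey; rewrite in_itv => /andP[].
rewrite truncate_gt //; apply/eqP; rewrite eq_le; apply/andP; split.
  by apply: ub_le_sup; [exists 1 | exists x => //; exact: truncate_gt].
by apply: ge_sup => //; exists (truncate x), x.
Qed.

(** The gap between [c] and [d] excludes members of [E] that decrease to [c] from above: there the
    left side would be [c] and the right side 1. *)
Lemma truncate_inf (d : R) : c < d -> (forall x, E x -> c < x -> d <= x) ->
  E `<=` `[0, 1] -> truncate (inf E) = inf (truncate @` E).
Proof.
move=> cd dE E01.
have Ege0 : lbound E 0 by move=> y /E01 /=; rewrite in_itv => /andP[].
have Elb : has_lbound E by exists 0.
have [cE|] := pselect (forall x, E x -> c < x).
  rewrite truncate_const // inf1 truncate_gt // (lt_le_trans cd) //.
  by apply: lb_le_inf => // x Ex; apply: dE => //; exact: cE.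
(* The member [z <= c] is fixed by truncation, so members above [c], moved to 1, affect neither
   infimum. *)
move=> /existsNP[z /not_implyP[Ez /negP]]; rewrite -leNgt => zc.
have ic : inf E <= c by rewrite (le_trans _ zc) //; exact: ge_inf.
have t_lb : lbound (truncate @` E) (inf E).
  move=> _ [x Ex <-]; have [xc|cx] := leP x c.
    by rewrite truncate_id //; exact: ge_inf.
  by rewrite truncate_gt // (le_trans ic) ?ltW.
have imE x : E x -> inf (truncate @` E) <= truncate x.
  by move=> Ex; apply: ge_inf; [exists (inf E) | exists x].
rewrite truncate_id //; apply/eqP; rewrite eq_le; apply/andP; split.
  by apply: lb_le_inf => //; exists (truncate z), z.
apply: lb_le_inf => // x Ex; have [xc|cx] := leP x c.
  by rewrite -[leRHS]truncate_id //; exact: imE.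
by rewrite (le_trans (imE _ Ez)) // truncate_id // (le_trans zc) ?ltW.
Qed.

End Truncation.

Section VUp.
Context (R : realType) (k : nat).
Hypothesis k_gt0 : (0 < k)%N.
Let c : R := 1 - k%:R^-1.

Lemma le_one_sub_inv (i j : nat) : (0 < i)%N -> (0 < j)%N ->
  (1 - i%:R^-1 <= 1 - j%:R^-1 :> R) = (i <= j)%N.
Proof.
by move=> i0 j0; rewrite lerD2l lerN2 lef_pV2 ?posrE ?ltr0n // ler_nat.
Qed.

Lemma V_up_gap x : V_up R x -> c < x -> 1 - k.+1%:R^-1 <= x.
Proof.
case=> [[j /= j0 <-]|-> _]; last by rewrite lerBlDr lerDl invr_ge0 ler0n.
by rewrite ltNge !le_one_sub_inv // -ltnNge.
Qed.

(** The index is [k.+1] because [V_fin R m] stops at [1 - 1/(m - 1)], which must equal [c]. *)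
Lemma truncate_V_fin x : V_up R x -> V_fin R k.+1 (truncate c x).
Proof.
case=> [[j /= j0 <-]|->]; last by right; exact: truncate1.
rewrite /truncate le_one_sub_inv //; case: ifP => [jk|_]; last by right.
by left; exists j; rewrite //= j0 subn1.
Qed.

Lemma G_fin_truncate (L : signature) (A : formula L)
    (I : interpretation L (V_up R)) :
  G_fin L R k.+1 A -> truncate c (truth_value I A) = 1.
Proof.
have c1 : c < 1 by rewrite ltrBlDr ltrDl invr_gt0 ltr0n.
have sub01 E : E `<=` V_up R -> E `<=` `[0, 1].
  by move=> EV; exact: subset_trans EV (@V_up_itv R).
apply: (goedel_logic_map truncate_V_fin (V_up_goedel R)).
- by rewrite truncate_id // subr_ge0 invf_le1 ?ltr0n // ler1n.
- exact: truncate1.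
- exact: truncate_homo.
- exact: truncate_imp.
(* The gap ends at the successor of [c] in [V_up]. *)
- move=> E E0 EV; apply: (truncate_inf c1 E0 (d := 1 - k.+1%:R^-1)).
  + by rewrite ltNge le_one_sub_inv // ltnn.
  + by move=> x /EV; exact: V_up_gap.
  + exact: sub01.
- by move=> E E0 EV; apply: truncate_sup => //; exact: sub01.
Qed.

End VUp.

Local Close Scope ring_scope.

Theorem theorem23 (L : signature) (R : realType) :
  G_up L R = \bigcap_(m in [set m : nat | (2 <= m)%N]) G_fin L R m.
Proof.
apply/seteqP; split => [A upA m /= m2|A finA I].
  exact: goedel_logic_sub (V_fin_goedel R m2) (@V_fin_up R m) _ upA.
have [[k /= k0 kA]|//] := formula_val_in (var_val I) A (V_up_goedel R).
(* Truncating at the value of [A] itself leaves that value fixed, so it must be 1; [k0] also serves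
   as [2 <= k.+1]. *)
have := G_fin_truncate k0 I (finA k.+1 k0).
by rewrite truncate_id // /truth_value kA.
Qed.
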